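(* Let $G$ be a connected graph, and let $G'$ be a graph obtained by identifying a vertex of $G$ with a vertex of the complete graph $K_3$ (taken disjoint from $G$). If ${\rm pind}(A_{G})=1$, then ${\rm pind}(A_{G'})=1$ and hence $G'$ is $(2,2)$-choosable.
   Context: Graphs are finite and simple. The permanent of an $m\times m$ real matrix $A=[a_{ij}]$ is ${\rm per}(A)=\sum_{\sigma}\prod_{i=1}^{m}a_{i\sigma(i)}$, summed over all permutations $\sigma$ of $\{1,\ldots,m\}$. The permanent index ${\rm pind}(A)$ of a matrix $A$ with $m$ rows is the minimum integer $k$ such that there is an $m\times m$ matrix $A'$ with ${\rm per}(A')\neq 0$, each column of which is a column of $A$, and such that each column of $A$ occurs in $A'$ at most $k$ times. For a graph $G$, fix an orientation of its edges. $A_G$ is the matrix with rows indexed by the edges of $G$ and columns indexed by the vertices and edges of $G$, where for $e=(u,v)$ (oriented from $u$ to $v$), $A_G[e,y]=1$ if $y=v$ or $y\neq e$ is an edge incident to $v$; $A_G[e,y]=-1$ if $y=u$ or $y\neq e$ is an edge incident to $u$; and $A_G[e,y]=0$ otherwise. (Reversing an edge multiplies the corresponding row by $-1$, so ${\rm pind}(A_G)$ does not depend on the orientation.) A total-weighting of $G=(V,E)$ is a mapping $f:V\cup E\to\mathbb{R}$. For $v\in V$ put $s(v)=f(v)+\sum_{e\in E(v)}f(e)$, where $E(v)$ is the set of edges incident with $v$. The total-weighting $f$ is proper if $s(u)\neq s(v)$ for any two adjacent vertices $u,v$. The graph $G$ is $(k,k')$-choosable if for every assignment $L$ of a set $L(v)$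 of $k$ real numbers to each vertex $v$ and a set $L(e)$ of $k'$ real numbers to each edge $e$, there is a proper total-weighting $f$ with $f(z)\in L(z)$ for all $z\in V\cup E$. *)

(* Defs.v *)
From HB Require Import structures.
From mathcomp Require Import all_boot all_order all_algebra all_fingroup.
From mathcomp Require Import finmap reals.

Set Implicit Arguments.
Unset Strict Implicit.
Unset Printing Implicit Defensive.

Import Order.TTheory GRing.Theory Num.Theory.
Local Open Scope ring_scope.

Record sgraph := SGraph {
  vertex :> finType;
  adj : rel vertex;
  adj_sym : symmetric adj;
  adj_irrefl : irreflexive adj }.

Definition connected (G : sgraph) : Prop := forall x y : G, connect (@adj G) x y.

Definition edge_set (G : sgraph) : {set {set G}} :=
  [set [set p.1; p.2] | p : G * G & adj p.1 p.2].

Definition edge (G : sgraph) : finType := {E : {set G} | E \in edge_set G}.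

Record orientation (G : sgraph) := Orientation {
  tail : edge G -> G;
  head : edge G -> G;
  orientation_ends : forall e : edge G, val e = [set tail e; head e] }.

Definition complete_rel (n : nat) : rel 'I_n := fun i j => i != j.

Lemma complete_rel_sym n : symmetric (@complete_rel n).
Proof. by move=> i j; rewrite /complete_rel eq_sym. Qed.

Lemma complete_rel_irrefl n : irreflexive (@complete_rel n).
Proof. by move=> i; rewrite /complete_rel eqxx. Qed.

Definition complete_graph (n : nat) : sgraph :=
  SGraph (@complete_rel_sym n) (@complete_rel_irrefl n).

Definition disjoint_union_adj (G H : sgraph) (x y : G + H) : bool :=
  match x, y with
  | inl a, inl b => adj a b
  | inr a, inr b => adj a b
  | _, _ => false
  end.

(* [q] is the quotient map from the disjoint union of G and H onto G' whose
   only non-trivial fibre is {u, w}; so G' is determined up to isomorphism. *)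
Definition is_identification (G H G' : sgraph) (u : G) (w : H) : Prop :=
  exists q : G + H -> G',
    [/\ forall z : G', exists x, q x = z,
        forall x y : G + H, q x = q y <->
          [\/ x = y, x = inl u /\ y = inr w | x = inr w /\ y = inl u]
      & forall a b : G', adj a b <->
          exists x y, [/\ q x = a, q y = b & disjoint_union_adj x y] ].

Definition permanent (R : comNzRingType) (m : nat) (A : 'M[R]_m) : R :=
  \sum_(s : 'S_m) \prod_(i < m) A i (s i).

(* The i-th column of A' is column [c i] of A; occurrences are counted by
   column index, so equal columns at different indices count separately. *)
Definition pind_le (R : comNzRingType) (m n : nat) (A : 'M[R]_(m, n))
    (k : nat) : Prop :=
  exists c : 'I_m -> 'I_n,
    permanent (colsub c A) != 0 /\
    forall j : 'I_n, (#|[set i | c i == j]| <= k)%N.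

(* A relation because no [k] need exist, e.g. when A has a zero row. *)
Definition is_pind (R : comNzRingType) (m n : nat) (A : 'M[R]_(m, n))
    (k : nat) : Prop :=
  pind_le A k /\ forall k', pind_le A k' -> (k <= k')%N.

Definition attached (G : sgraph) (e : edge G) (x : G) (y : G + edge G) : bool :=
  match y with
  | inl z => z == x
  | inr e' => (e' != e) && (x \in val e')
  end.

(* G is simple, so no [y] is attached to both ends of [e] and the order of the
   two tests is irrelevant. *)
Definition graph_entry (R : comNzRingType) (G : sgraph) (o : orientation G)
    (e : edge G) (y : G + edge G) : R :=
  if attached e (head o e) y then 1
  else if attached e (tail o e) y then -1
  else 0.

Definition graph_matrix (R : comNzRingType) (G : sgraph) (o : orientation G) :
    'M[R]_(#|{: edge G}|, #|{: G + edge G}|) :=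
  \matrix_(i, j) graph_entry R o (enum_val i) (enum_val j).

Definition weight_sum (R : realType) (G : sgraph) (f : G + edge G -> R)
    (v : G) : R :=
  f (inl v) + \sum_(e : edge G | v \in val e) f (inr e).

Definition proper_weighting (R : realType) (G : sgraph)
    (f : G + edge G -> R) : Prop :=
  forall u v : G, adj u v -> weight_sum f u <> weight_sum f v.

Definition choosable (R : realType) (G : sgraph) (k k' : nat) : Prop :=
  forall L : G + edge G -> {fset R},
    (forall v : G, #|` L (inl v)| = k) ->
    (forall e : edge G, #|` L (inr e)| = k') ->
    exists f : G + edge G -> R,
      proper_weighting f /\ forall z : G + edge G, f z \in L z.

(* Main.v *)
Require Import Defs.
From HB Require Import structures.
From mathcomp Require Import all_boot all_order all_algebra all_fingroup.
From mathcomp Require Import finmap reals ring.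

(** Expanding a product of affine forms in signs gives a formula of Glynn type:
    averaging [(prod_k eps_k) * prod_i (r_i + sum_k eps_k M_ik)] over all sign
    vectors [eps] leaves only the terms in which every sign occurs once in the
    product, and these make up the permanent of [M] ([glynn]).  It is used in
    two ways.

    With the signs attached to the columns it is the instance of the
    Combinatorial Nullstellensatz that turns the permanent index into
    choosability.  In a total-weighting [f] the difference [s(v) - s(u)] along
    an edge [(u, v)] is the entry of [A_G f] at this edge.  Write the two
    allowed values of each selected column as midpoint plus or minus half
    difference: if no choice made all entries of [A_G f] nonzero, then every
    summand of the formula would vanish, hence also the permanent
    ([pind_le1_nonvanishing], [pind_le1_choosable]).

    With the signs attached to the rows, [eps] is an orientation of the graph.
    The vertex [v] then contributes as its factor the excess [D(v)] of entering
    over leaving edges, and the edge [vv'] contributes [D(v) + D(v')].  Up to a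
    power of two, the permanent of a set [C] of columns is therefore a signed
    sum over orientations of products of excesses ([permanent_signed_sum]).

    Let the triangle be [u, x, y], and let [C] be a set of columns with nonzero
    permanent for [G].  To [C], read in [G'], add the columns of [x], [y] and of
    the edge [ux].  At [x] and at [y] only triangle edges occur, so [D(x)] and
    [D(y)] are both nonzero only when one of [x], [y] is a source and the other
    a sink.  In that case the triangle contributes zero to [D(u)], so every
    column of [C] keeps its value in [G], while
    [D(x) D(y) (D(u) + D(x)) = -4 (D(u) +- 2)].  The two remaining orientations
    of the triangle have opposite signs, so [D(u)] cancels and the signed sum is
    multiplied by 16 ([signed_sum_triangle]); the permanent is doubled. *)

Set Implicit Arguments.
Unset Strict Implicit.
Unset Printing Implicit Defensive.

Import Order.TTheory GRing.Theory Num.Theory.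
Local Open Scope ring_scope.

(** * Sums and products over option types *)

Lemma big_option (T : Type) (idx : T) (op : Monoid.com_law idx) (I : finType)
    (F : option I -> T) :
  \big[op/idx]_(o : option I) F o = op (F None) (\big[op/idx]_(i : I) F (Some i)).
Proof.
rewrite (bigD1 None) //=; congr (op _ _).
rewrite (reindex_omap Some id) => [|[i|] //].
by apply: eq_bigl => i; rewrite /= eqxx.
Qed.

Lemma sum_ffun_option (V : nmodType) (I T : finType) (F : {ffun option I -> T} -> V) :
  \sum_eps F eps =
  \sum_(eps : {ffun I -> T}) \sum_b F [ffun o => if o is Some i then eps i else b].
Proof.
rewrite pair_big /=.
rewrite (reindex (fun p : {ffun I -> T} * T =>
  [ffun o => if o is Some i then p.1 i else p.2])) //=.
exists (fun eps : {ffun option I -> T} => ([ffun i => eps (Some i)], eps None)).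
  move=> [eps b] _; rewrite !ffunE /=; congr (_, _).
  by apply/ffunP => i; rewrite !ffunE.
by move=> eps _; apply/ffunP => -[i|]; rewrite !ffunE.
Qed.

(** * The permanent as a sum over signs *)

(** The term of the expansion that contributes to the permanent picks, from the
    [m] factors, [m] distinct signs; this leaves no factor for the constant. *)
Lemma surj_option_perm (I : finType) (f : I -> option I) :
  (forall k, exists i, f i = Some k) -> exists s : {perm I}, forall i, f i = Some (s i).
Proof.
move=> f_onto; have [g fg] := fin_all_exists f_onto.
have g_inj : injective g by move=> k l gkl; apply: Some_inj; rewrite -!fg gkl.
exists (perm g_inj)^-1%g => i.
by rewrite -{1}[i](permKV (perm g_inj)) permE fg.
Qed.

(** Multiplying by the product of all signs and summing kills every monomial in
    which some sign is missing.  A product of [m] forms that involves all [m]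
    signs leaves room for no constant [r i], so it is a term of the permanent. *)
Lemma glynn (R : comNzRingType) m (M : 'M[R]_m) (r : 'I_m -> R) :
  \sum_(eps : {ffun 'I_m -> bool}) (\prod_k (-1) ^+ eps k) *
     \prod_i (r i + \sum_k (-1) ^+ eps k * M i k) =
  2 ^+ m * permanent M.
Proof.
(* The index [None] selects the constant [r i], and [Some k] the k-th summand. *)
pose coef i o := if o is Some k then M i k else r i.
pose mono (o : option 'I_m) k (b : bool) : R := if o == Some k then (-1) ^+ b else 1.
have expand (eps : {ffun 'I_m -> bool}) i :
    r i + \sum_k (-1) ^+ eps k * M i k =
    \sum_o coef i o * \prod_k mono o k (eps k).
  rewrite big_option /= [X in _ = _ * X + _]big1 // mulr1; congr (_ + _).
  apply: eq_bigr => k _; rewrite mulrC /mono (bigD1 k) //= eqxx big1 ?mulr1 //.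
  by move=> l lk; rewrite (inj_eq Some_inj) eq_sym (negPf lk).
(* Exchanging the sums makes the sum over [eps] a product over [k]. *)
pose T (f : {ffun 'I_m -> option 'I_m}) :=
  (\prod_i coef i (f i)) *
  \prod_k \sum_(b : bool) (-1) ^+ b * \prod_i mono (f i) k b.
transitivity (\sum_f T f).
  transitivity (\sum_(eps : {ffun 'I_m -> bool})
      \sum_(f : {ffun 'I_m -> option 'I_m}) (\prod_k (-1) ^+ eps k) *
      \prod_i (coef i (f i) * \prod_k mono (f i) k (eps k))).
    apply: eq_bigr => eps _; rewrite -mulr_sumr.
    rewrite -(bigA_distr_bigA (fun i o => coef i o * \prod_k mono o k (eps k))).
    by congr (_ * _); apply: eq_bigr => i _; rewrite expand.
  rewrite exchange_big; apply: eq_bigr => f _.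
  rewrite /T bigA_distr_bigA mulr_sumr; apply: eq_bigr => eps _.
  by rewrite !big_split /= [X in _ * (_ * X)]exchange_big mulrCA.
pose h (s : 'S_m) : {ffun 'I_m -> option 'I_m} := [ffun i => Some (s i)].
have h_inj : injective h.
  move=> s t hst; apply/permP => i.
  have := congr1 (fun f : {ffun 'I_m -> option 'I_m} => f i) hst.
  by rewrite !ffunE; case.
rewrite (bigID [in [set h s | s in [set: 'S_m]]]) /= addrC big1 ?add0r; last first.
  move=> f notperm; have [k /existsP missed] : exists k, ~~ [exists i, f i == Some k].
    apply/existsP; rewrite -negb_forall; apply: contra notperm => /forallP onto.
    have [i|s fE] := @surj_option_perm _ f.
      by have /existsP[j /eqP] := onto i; exists j.
    by apply/imsetP; exists s; rewrite ?inE //; apply/ffunP => i; rewrite ffunE.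
  (* The sign [k] occurs only in the leading product, and its two values cancel. *)
  have mono1 b : \prod_i mono (f i) k b = 1.
    apply: big1 => i _; rewrite /mono; case: eqP => // fi.
    by case: missed; exists i; apply/eqP.
  by rewrite /T [X in _ * X](bigD1 k) //= big_bool !mono1 !mulr1 /=
     expr1 expr0 addNr mul0r mulr0.
rewrite big_imset /=; last by move=> s t _ _ /h_inj.
rewrite /permanent mulr_sumr.
under eq_bigl => s do rewrite inE.
apply: eq_bigr => s _; rewrite mulrC; congr (_ * _).
  by apply: eq_bigr => i _; rewrite ffunE.
transitivity (\prod_(k < m) (2 : R)); last by rewrite prodr_const card_ord.
apply: eq_bigr => k _.
(* Each sign occurs exactly twice, which gives a square. *)
have one b : \prod_i mono (h s i) k b = (-1) ^+ b.
  rewrite /mono -big_mkcond (big_pred1 (s^-1 k)%g) // => i.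
  by rewrite /= ffunE (inj_eq Some_inj) (canF_eq (permK s)).
by rewrite big_bool /= !one expr1 expr0 mulrNN mulr1.
Qed.

Lemma permanent_tr (R : comNzRingType) m (M : 'M[R]_m) :
  permanent M^T = permanent M.
Proof.
rewrite /permanent (reindex_inj invg_inj); apply: eq_bigr => s _.
rewrite (reindex_inj (@perm_inj _ s)); apply: eq_bigr => i _.
by rewrite mxE permK.
Qed.

(** This is the sum in [glynn] with signs attached to rows.  Its rows and columns
    are indexed by arbitrary finite types, so that edges, vertices and sets of
    columns can be used without numbering them. *)
Definition signed_sum (R : comNzRingType) (I J : finType) (M : I -> J -> R)
    (C : {set J}) : R :=
  \sum_(eps : {ffun I -> bool}) (\prod_i (-1) ^+ eps i) *
    \prod_(j in C) \sum_i (-1) ^+ eps i * M i j.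

Lemma signed_sum_reindex (R : comNzRingType) (I I' J : finType) (phi : I' -> I)
    (M : I -> J -> R) (C : {set J}) :
  bijective phi -> signed_sum (fun i => M (phi i)) C = signed_sum M C.
Proof.
move=> bij_phi; have [psi phiK psiK] := bij_phi.
rewrite /signed_sum (reindex (fun eps : {ffun I -> bool} => [ffun i' => eps (phi i')])).
  apply: eq_bigr => eps _; rewrite [in RHS](reindex phi) /=; last exact: onW_bij.
  congr (_ * _); first by apply: eq_bigr => i _; rewrite ffunE.
  apply: eq_bigr => j _; rewrite [in RHS](reindex phi) /=; last exact: onW_bij.
  by apply: eq_bigr => i _; rewrite ffunE.
exists (fun eps : {ffun I' -> bool} => [ffun i => eps (psi i)]) => eps _;
  by apply/ffunP => i; rewrite !ffunE ?phiK ?psiK.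
Qed.

Lemma signed_sum_flip (R : comNzRingType) (I J : finType) (sigma : I -> bool)
    (M : I -> J -> R) (C : {set J}) :
  signed_sum (fun i j => (-1) ^+ sigma i * M i j) C =
  (\prod_i (-1) ^+ sigma i) * signed_sum M C.
Proof.
rewrite /signed_sum mulr_sumr.
rewrite (reindex_inj (h := fun eps : {ffun I -> bool} => [ffun i => sigma i (+) eps i])).
  apply: eq_bigr => eps _; rewrite mulrA -big_split; congr (_ * _).
    by apply: eq_bigr => i _; rewrite ffunE signr_addb.
  apply: eq_bigr => j _; apply: eq_bigr => i _.
  by rewrite ffunE signr_addb mulrACA -expr2 sqrr_sign mul1r.
move=> eps eps' /ffunP eq_flip; apply/ffunP => i.
by have := eq_flip i; rewrite !ffunE; apply: addbI.
Qed.

Lemma permanent_signed_sum (R : comNzRingType) (I J : finType) (M : I -> J -> R)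
    (c : 'I_#|I| -> J) :
  injective c ->
  2 ^+ #|I| * permanent (\matrix_(i, k) M (enum_val i) (c k)) =
  signed_sum M [set c k | k in 'I_#|I|].
Proof.
move=> c_inj; rewrite -permanent_tr -(glynn _ (fun=> 0)).
rewrite -(signed_sum_reindex M _ (enum_val_bij I)).
apply: eq_bigr => eps _; rewrite big_imset /=; last by move=> ? ? _ _ /c_inj.
congr (_ * _); apply: eq_bigr => k _; rewrite add0r.
by apply: eq_bigr => i _; rewrite !mxE.
Qed.

(** * Permanent index one *)

Lemma pind_le1P (R : comNzRingType) m n (A : 'M[R]_(m, n)) :
  pind_le A 1 <-> exists2 c : 'I_m -> 'I_n, injective c & permanent (colsub c A) != 0.
Proof.
split=> [[c [per_neq0 once]] | [c c_inj per_neq0]]; exists c => //.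
  by move=> i i' cii'; apply: (card_le1_eqP (once (c i'))); rewrite inE ?cii'.
split=> // j; apply/card_le1_eqP => i i'; rewrite !inE => /eqP <- /eqP.
by move/c_inj.
Qed.

(** The Combinatorial Nullstellensatz for a product of linear forms and lists of
    size two: the coefficient of the monomial of the selected columns is the
    permanent, and [glynn] recovers it from the values on the grid. *)
Lemma pind_le1_nonvanishing (R : numFieldType) m n (A : 'M[R]_(m, n)) (a b : 'I_n -> R) :
  pind_le A 1 -> (forall j, a j != b j) ->
  exists x : 'I_n -> R,
    (forall j, x j = a j \/ x j = b j) /\ forall i, \sum_j A i j * x j != 0.
Proof.
move=> /pind_le1P[c c_inj per_neq0] ab.
pose mid j := (a j + b j) / 2; pose half j := (a j - b j) / 2.
pose B := \matrix_(i, k) (A i (c k) * half (c k)).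
have perB : permanent B != 0.
  have -> : permanent B = permanent (colsub c A) * \prod_k half (c k).
    rewrite /permanent mulr_suml; apply: eq_bigr => s _.
    rewrite [X in _ * X](reindex_inj (@perm_inj _ s)) -big_split.
    by apply: eq_bigr => i _; rewrite !mxE.
  rewrite mulf_neq0 // prodf_seq_neq0; apply/allP => k _ /=.
  by rewrite mulf_neq0 ?subr_eq0 // invr_eq0 pnatr_eq0.
pose sign (eps : {ffun 'I_m -> bool}) j : bool :=
  if [pick k | c k == j] is Some k then eps k else false.
pose x eps j := mid j + (-1) ^+ sign eps j * half j.
(* Unselected columns keep the value [a]: they only enter the constants. *)
pose r i := \sum_j A i j * mid j + \sum_(j | j \notin codom c) A i j * half j.
have rowE eps i : \sum_j A i j * x eps j = r i + \sum_k (-1) ^+ eps k * B i k.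
  rewrite /x /sign; under eq_bigr do rewrite mulrDr.
  rewrite big_split -addrA; congr (_ + _).
  rewrite (bigID [in codom c]) /= addrC; congr (_ + _).
    apply: eq_bigr => j jc; case: pickP => [k /eqP ck|_]; last by rewrite mul1r.
    by rewrite -ck codom_f in jc.
  rewrite (eq_bigl [in [set c k | k in 'I_m]]); last first.
    move=> j; apply/codomP/imsetP => [[k ->]|[k _ ->]]; by exists k.
  rewrite big_imset /=; last by move=> ? ? _ _ /c_inj.
  apply: eq_bigr => k _; rewrite mxE mulrCA.
  by case: pickP => [l /eqP/c_inj -> //|/(_ k)]; rewrite eqxx.
have [eps prod_neq0] : exists eps, \prod_i (\sum_j A i j * x eps j) != 0.
  apply/existsP; apply: contraNT perB; rewrite negb_exists => /forallP zero.
  have := glynn B r; rewrite big1 => [/esym/eqP|eps _].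
    by rewrite mulf_eq0 expf_eq0 pnatr_eq0 andbF.
  under [X in _ * X]eq_bigr do rewrite -rowE.
  by have /negbNE/eqP -> := zero eps; rewrite mulr0.
exists (x eps); split=> [j|i]; last by move/prodf_neq0: prod_neq0; apply.
rewrite /x /mid /half; case: (sign eps j) => /=.
- by right; rewrite expr1; field.
- by left; rewrite expr0; field.
Qed.

Lemma pind_le1_signed_sum (R : numFieldType) (G : sgraph) (o : orientation G) :
  pind_le (graph_matrix R o) 1 <->
  exists2 C : {set G + edge G},
    #|C| = #|{: edge G}| & signed_sum (graph_entry R o) C != 0.
Proof.
have bridge (c : 'I_#|{: edge G}| -> 'I_#|{: G + edge G}|) : injective c ->
    (signed_sum (graph_entry R o) [set enum_val (c k) | k in 'I_#|{: edge G}|] != 0) =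
    (permanent (colsub c (graph_matrix R o)) != 0).
  move=> c_inj; rewrite -permanent_signed_sum; last by move=> k l /enum_val_inj/c_inj.
  rewrite mulf_eq0 expf_eq0 pnatr_eq0 andbF /=; congr (permanent _ != 0).
  by apply/matrixP => i k; rewrite !mxE.
split=> [/pind_le1P[c c_inj per_neq0]|[C cardC sum_neq0]].
  exists [set enum_val (c k) | k in 'I_#|{: edge G}|]; last by rewrite bridge.
  by rewrite card_imset ?card_ord // => k l /enum_val_inj/c_inj.
apply/pind_le1P.
pose c (k : 'I_#|{: edge G}|) := enum_rank (enum_val (cast_ord (esym cardC) k)).
have c_inj : injective c by move=> k l /enum_rank_inj/enum_val_inj/cast_ord_inj.
exists c; rewrite // -bridge //; congr (signed_sum _ _ != 0): sum_neq0.
apply/setP => y; apply/idP/imsetP => [yC|[k _ ->]]; last first.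
  by rewrite enum_rankK enum_valP.
exists (cast_ord cardC (enum_rank_in yC y)) => //.
by rewrite enum_rankK cast_ordK enum_rankK_in.
Qed.

(** * Edges and incidences *)

Lemma set2_inj (T : finType) (a b c d : T) :
  [set a; b] = [set c; d] -> a = c /\ b = d \/ a = d /\ b = c.
Proof.
move=> eq_ab; have /set2P a_cd : a \in [set c; d] by rewrite -eq_ab set21.
have /set2P b_cd : b \in [set c; d] by rewrite -eq_ab set22.
have /set2P c_ab : c \in [set a; b] by rewrite eq_ab set21.
have /set2P d_ab : d \in [set a; b] by rewrite eq_ab set22.
by case: a_cd => a_eq; case: b_cd => b_eq;
  case: c_ab => c_eq; case: d_ab => d_eq; subst; auto.
Qed.

Lemma edge_of_adj (G : sgraph) (a b : G) :
  adj a b -> exists e : edge G, val e = [set a; b].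
Proof.
move=> ab; have e_in : [set a; b] \in edge_set G.
  by apply/imsetP; exists (a, b); rewrite ?inE.
by exists (Sub [set a; b] e_in); rewrite SubK.
Qed.

Lemma adj_of_edge (G : sgraph) (e : edge G) (a b : G) : val e = [set a; b] -> adj a b.
Proof.
case/imsetP: (valP e) => -[c d]; rewrite inE /= => cd ->.
by case/set2_inj=> [[<- <-] | [<- <-]]; rewrite // adj_sym.
Qed.

Lemma adj_neq (G : sgraph) (a b : G) : adj a b -> a != b.
Proof. by apply: contraTneq => ->; rewrite adj_irrefl. Qed.

Lemma ends_eq (G : sgraph) (e e' : edge G) (a b : G) :
  a != b -> val e = [set a; b] -> a \in val e' -> b \in val e' -> e' = e.
Proof.
move=> ab eE; case/imsetP: (valP e') => -[c d] /= _ e'E; rewrite e'E => ae be.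
apply: val_inj; rewrite [LHS]e'E [RHS]eE; apply/esym.
case/set2P: ae ab be => -> ab /set2P[] eq_b; rewrite ?eq_b ?eqxx // in ab *.
by rewrite setUC.
Qed.

Lemma orientation_exists (G : sgraph) : inhabited (orientation G).
Proof.
have ends (e : edge G) : exists p : G * G, val e = [set p.1; p.2].
  by case/imsetP: (valP e) => p _ eE; exists p.
have [p pE] := fin_all_exists ends.
exact: (inhabits (@Orientation G (fun e => (p e).1) (fun e => (p e).2) pE)).
Qed.

Definition touches (G : sgraph) (v : G) (y : G + edge G) : bool :=
  match y with inl z => z == v | inr e => v \in val e end.

(** The difference of two incidences, so that row sums become differences of
    vertex quantities.  For an edge [e] with ends [t] and [h] it vanishes at the
    column of [e] itself, where both incidences are 1. *)
Definition arc_row (R : comNzRingType) (G : sgraph) (t h : G) (y : G + edge G) : R :=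
  (touches h y)%:R - (touches t y)%:R.

Lemma graph_entryE (R : comNzRingType) (G : sgraph) (o : orientation G)
    (e : edge G) (y : G + edge G) :
  graph_entry R o e y = arc_row R (tail o e) (Defs.head o e) y.
Proof.
have eE := orientation_ends o e.
have th : tail o e != Defs.head o e by apply: adj_neq; apply: adj_of_edge eE.
have [te he] : tail o e \in val e /\ Defs.head o e \in val e by rewrite eE set21 set22.
rewrite /graph_entry /arc_row; case: y => [z|e'] /=.
  have [->|_] := eqVneq z (Defs.head o e); last first.
    by case: eqP => _ /=; rewrite ?subr0 ?sub0r.
  by rewrite /= eq_sym (negPf th) subr0.
have [->|ne] := eqVneq e' e; first by rewrite te he subrr.
case h_e': (Defs.head o e \in val e'); case t_e': (tail o e \in val e');
  rewrite /= ?subr0 ?sub0r ?oppr0 //.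
by case/eqP: ne; apply: (ends_eq th eE).
Qed.

(** Reversing an edge negates its row, so every directed description of the edges
    computes the signed sum of every orientation, up to sign. *)
Lemma signed_sum_orientation (R : comNzRingType) (G : sgraph) (o : orientation G)
    (I : finType) (phi : I -> edge G) (tl hd : I -> G) (C : {set G + edge G}) :
  bijective phi -> (forall i, val (phi i) = [set tl i; hd i]) ->
  exists b : bool, signed_sum (graph_entry R o) C =
    (-1) ^+ b * signed_sum (fun i => arc_row R (tl i) (hd i)) C.
Proof.
move=> bij_phi phiE; pose sigma i := Defs.head o (phi i) != hd i.
exists (odd (\sum_i sigma i)); rewrite signr_odd.
have -> : (-1 : R) ^+ (\sum_i sigma i)%N = \prod_i (-1) ^+ sigma i.
  by rewrite (big_morph _ (exprD _) (expr0 _)).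
rewrite -signed_sum_flip -(signed_sum_reindex _ _ bij_phi).
apply: eq_bigr => eps _; congr (_ * _); apply: eq_bigr => y _.
apply: eq_bigr => i _; congr (_ * _); rewrite graph_entryE /sigma /arc_row.
have := orientation_ends o (phi i); rewrite phiE => /set2_inj[[-> <-]|[-> ->]].
  by rewrite eqxx mul1r.
have /adj_neq : adj (tail o (phi i)) (Defs.head o (phi i)).
  exact: adj_of_edge (orientation_ends o (phi i)).
by rewrite eq_sym => ->; rewrite mulN1r opprB.
Qed.

(** * From the permanent index to choosability *)

Lemma weight_sum_touches (R : realType) (G : sgraph) (f : G + edge G -> R) (v : G) :
  weight_sum f v = \sum_y (touches v y)%:R * f y.
Proof.
rewrite /weight_sum big_sumType /=; congr (_ + _).
  rewrite (bigD1 v) //= eqxx mul1r big1 ?addr0 // => z zv.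
  by rewrite (negPf zv) mul0r.
by rewrite big_mkcond; apply: eq_bigr => e _; case: ifP; rewrite ?mul1r ?mul0r.
Qed.

(** The entry of [A_G f] at an edge is the difference of the weight sums of its
    ends, because the weight of the edge itself occurs in both. *)
Lemma pind_le1_choosable (R : realType) (G : sgraph) (o : orientation G) :
  pind_le (graph_matrix R o) 1 -> choosable R G 2 2.
Proof.
move=> pind1 L cardLv cardLe.
have pairs z : exists p : R * R, [/\ p.1 != p.2, p.1 \in L z & p.2 \in L z].
  have sizeL : size (L z) = 2 by case: z.
  case Lz: (enum_fset (L z)) sizeL (fset_uniq (L z)) => [|a [|b []]] //= _.
  rewrite inE andbT => ab.
  have memL x : (x \in L z) = (x \in [:: a; b]) by rewrite -Lz.
  by exists (a, b); rewrite !memL !inE !eqxx orbT.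
have [p pE] := fin_all_exists pairs.
have [|x [x_ab x_row]] := pind_le1_nonvanishing (a := fun j => (p (enum_val j)).1)
  (b := fun j => (p (enum_val j)).2) pind1; first by move=> j; case: (pE (enum_val j)).
pose f z := x (enum_rank z); exists f; split=> [a b ab|z]; last first.
  have [_ az bz] := pE z; rewrite /f.
  by have := x_ab (enum_rank z); rewrite enum_rankK => -[->|->].
have [e eE] := edge_of_adj ab.
have := x_row (enum_rank e).
have -> : \sum_j graph_matrix R o (enum_rank e) j * x j =
          weight_sum f (Defs.head o e) - weight_sum f (tail o e).
  rewrite !weight_sum_touches -sumrB (reindex _ (onW_bij _ (enum_rank_bij _))) /=.
  by apply: eq_bigr => y _; rewrite mxE !enum_rankK graph_entryE mulrBl.
rewrite subr_eq0 => /eqP ne.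
have := orientation_ends o e; rewrite eE => /set2_inj[[-> ->]|[-> ->] //].
by move/esym.
Qed.

(** * Attaching a triangle *)

(** The graph obtained by the identification, up to isomorphism: [g] embeds [G]
    as an induced subgraph, and [x], [y] are the other two vertices of the
    triangle at [g u]. *)
Record triangle_attached (G G' : sgraph) (u : G) (g : G -> G') (x y : G') : Prop :=
  TriangleAttached {
    ta_inj : injective g;
    ta_xy : x != y;
    ta_gx : forall v, g v != x;
    ta_gy : forall v, g v != y;
    ta_cover : forall z, [\/ z = x, z = y | exists v, z = g v];
    ta_adj : forall a b, adj (g a) (g b) = adj a b;
    ta_adjx : forall a, adj (g a) x = (a == u);
    ta_adjy : forall a, adj (g a) y = (a == u);
    ta_adjxy : adj x y }.

Lemma identification_triangle (G G' : sgraph) (u : G) (w : complete_graph 3) :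
  is_identification G' u w -> exists g x y, @triangle_attached G G' u g x y.
Proof.
case=> q [q_onto q_eq q_adj].
have /cards2P[i [j [ij eq_ij]]] : #|[set~ w]| == 2 by rewrite cardsC1 card_ord.
have [wi wj] : i != w /\ j != w.
  by rewrite -!in_setC1 eq_ij set21 set22.
have cover k : [\/ k = w, k = i | k = j].
  have [->|] := eqVneq k w; first by constructor.
  by rewrite -in_setC1 eq_ij => /set2P[] ->; [constructor 2 | constructor 3].
exists (fun v => q (inl v)), (q (inr i)), (q (inr j)).
have adjP a b :
    reflect (exists x y, [/\ q x = a, q y = b & disjoint_union_adj x y]) (adj a b).
  by apply/(iffP idP); rewrite q_adj.
have qE a b : q a = q b -> [\/ a = b, a = inl u /\ b = inr w | a = inr w /\ b = inl u].
  by move/q_eq.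
split.
- by move=> a b /qE[[]|[]|[]].
- by apply/eqP => /qE[[]|[]|[]] //; apply/eqP.
- by move=> v; apply/eqP => /qE[|[_ []]|[]] // /eqP; apply/negP.
- by move=> v; apply/eqP => /qE[|[_ []]|[]] // /eqP; apply/negP.
- move=> z; have [[v|k] <-] := q_onto z; first by constructor 3; exists v.
  have [->|->|->] := cover k; [constructor 3; exists u | by constructor | by constructor].
  by apply/esym/q_eq; constructor 2.
- move=> a b; apply/adjP/idP => [[[c|k] [[d|l] [/qE e1 /qE e2 ab]]]|ab] //=.
  + by case: e1 e2 ab => [[->]|[]|[]] // [[->]|[]|[]].
  + case: e1 ab => [|[]|[[->] _]] //; case: e2 => [|[]|[[->] _]] //.
    by rewrite /= /complete_rel eqxx.
  + by exists (inl a), (inl b).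
- move=> a; apply/adjP/eqP => [[[c|k] [[d|l] [/qE e1 /qE e2 ab]]]|->] //=.
  + by case: e2 => [|[_ [iw]]|[]] //; rewrite iw eqxx in wi.
  + by case: e1 => [|[]|[]] // _ [].
  + exists (inr w), (inr i); split=> //; last by rewrite /= /complete_rel eq_sym.
    by apply/q_eq; constructor 3.
- move=> a; apply/adjP/eqP => [[[c|k] [[d|l] [/qE e1 /qE e2 ab]]]|->] //=.
  + by case: e2 => [|[_ [iw]]|[]] //; rewrite iw eqxx in wj.
  + by case: e1 => [|[]|[]] // _ [].
  + exists (inr w), (inr j); split=> //; last by rewrite /= /complete_rel eq_sym.
    by apply/q_eq; constructor 3.
- by apply/adjP; exists (inr i), (inr j).
Qed.

(** The edges of [G'] are those of [G] and three more.  The triangle is directed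
    cyclically, [u -> x -> y -> u], so that two consecutive triangle edges add the
    difference of their signs to the excess of the vertex between them. *)
Notation arc G := (option (option (option (edge G)))).

Definition arc_tail (G G' : sgraph) (u : G) (g : G -> G') (x y : G') (o : orientation G)
    (i : arc G) : G' :=
  match i with
  | None => g u
  | Some None => x
  | Some (Some None) => y
  | Some (Some (Some e)) => g (tail o e)
  end.

Definition arc_head (G G' : sgraph) (u : G) (g : G -> G') (x y : G') (o : orientation G)
    (i : arc G) : G' :=
  match i with
  | None => x
  | Some None => y
  | Some (Some None) => g u
  | Some (Some (Some e)) => g (Defs.head o e)
  end.

Lemma arc_bijection (G G' : sgraph) (u : G) (g : G -> G') (x y : G')
    (o : orientation G) :
  triangle_attached u g x y ->
  exists2 phi : arc G -> edge G', bijective phi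
    & forall i, val (phi i) = [set arc_tail u g x y o i; arc_head u g x y o i].
Proof.
case=> g_inj xy gx gy cover adj_g adj_gx adj_gy adj_xy.
pose tl := arc_tail u g x y o; pose hd := arc_head u g x y o.
have xg v : (x == g v) = false by rewrite eq_sym (negPf (gx v)).
have yg v : (y == g v) = false by rewrite eq_sym (negPf (gy v)).
have yx : (y == x) = false by rewrite eq_sym (negPf xy).
have arc_adj i : adj (tl i) (hd i).
  case: i => [[[e|]|]|] //=; last by rewrite adj_gx.
    by rewrite adj_g; apply: adj_of_edge (orientation_ends o e).
  by rewrite adj_sym adj_gy.
have [phi phiE] := fin_all_exists (fun i => edge_of_adj (arc_adj i)).
exists phi => //.
have phi_inj : injective phi.
  move=> i j eq_ij; have := phiE j; rewrite -eq_ij phiE => eq_arc.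
  (* Which of [x] and [y] an edge contains tells the four kinds of edges apart. *)
  have := congr1 (fun A : {set G'} => y \in A) eq_arc.
  have := congr1 (fun A : {set G'} => x \in A) eq_arc.
  move: eq_arc; rewrite !inE.
  case: i j {eq_ij} => [[[e|]|]|] [[[e'|]|]|] //=;
    rewrite ?eqxx ?xg ?yg ?yx ?(negPf xy) ?orbT //= => eq_arc _ _.
  do 3![congr Some]; apply: val_inj; apply: (imset_inj g_inj).
  by rewrite /= !(orientation_ends o) !imsetU1 !imset_set1.
have phi_onto e' : exists i, phi i = e'.
  case/imsetP: (valP e') => -[a b]; rewrite inE /= => + e'E.
  have found i : [set a; b] = [set tl i; hd i] -> exists i, phi i = e'.
    by move=> abE; exists i; apply: val_inj; rewrite phiE [RHS]e'E.
  move: found; have [->|->|[v ->]] := cover a;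
    have [->|->|[v' ->]] := cover b; rewrite ?adj_irrefl // => found.
  - by move=> _; apply: (found (Some None)).
  - by rewrite adj_sym adj_gx => /eqP v'u; apply: (found None); rewrite /= v'u setUC.
  - by move=> _; apply: (found (Some None)); rewrite /= setUC.
  - by rewrite adj_sym adj_gy => /eqP v'u; apply: (found (Some (Some None))); rewrite v'u.
  - by rewrite adj_gx => /eqP vu; apply: (found None); rewrite vu.
  - by rewrite adj_gy => /eqP vu; apply: (found (Some (Some None))); rewrite /= vu setUC.
  - rewrite adj_g => /edge_of_adj[e eE]; apply: (found (Some (Some (Some e)))).
    transitivity (g @: val e); first by rewrite eE imsetU1 imset_set1.
    by rewrite (orientation_ends o e) imsetU1 imset_set1.
have [psi psiK] := fin_all_exists phi_onto.
by exists psi => // i; apply: phi_inj.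
Qed.

(** The columns added are those of [x], [y] and of the edge [ux].  The factor 16
    is 2 (by which the permanent grows) times [2 ^ 3] for the new signs. *)
Lemma signed_sum_triangle (R : comNzRingType) (G G' : sgraph) (u : G) (g : G -> G')
    (x y : G') (o : orientation G) (phi : arc G -> edge G') (C : {set G + edge G}) :
    triangle_attached u g x y -> bijective phi ->
    (forall i, val (phi i) = [set arc_tail u g x y o i; arc_head u g x y o i]) ->
  exists2 C' : {set G' + edge G'}, #|C'| = (#|C| + 3)%N
    & signed_sum
      (fun i => arc_row R (arc_tail u g x y o i) (arc_head u g x y o i)) C' =
    16 * signed_sum (graph_entry R o) C.
Proof.
move=> [g_inj xy gx gy _ _ _ _ _] bij_phi phiE.
pose M' i := arc_row R (arc_tail u g x y o i) (arc_head u g x y o i).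
rewrite -/M'.
have xg v : (x == g v) = false by rewrite eq_sym (negPf (gx v)).
have yg v : (y == g v) = false by rewrite eq_sym (negPf (gy v)).
have yx : (y == x) = false by rewrite eq_sym (negPf xy).
pose psi (z : G + edge G) : G' + edge G' :=
  match z with inl v => inl (g v) | inr e => inr (phi (Some (Some (Some e)))) end.
have psi_inj : injective psi.
  by move=> [v|e] [v'|e'] //= [] => [/g_inj -> //|/(bij_inj bij_phi)[->]].
have g_psi v z : touches (g v) (psi z) = touches v z.
  case: z => [v'|e] /=; first by rewrite (inj_eq g_inj).
  by rewrite phiE (orientation_ends o e) !inE !(inj_eq g_inj).
have x_psi z : touches x (psi z) = false.
  by case: z => [v'|e] /=; rewrite ?phiE ?inE ?xg ?(negPf (gx _)).
have y_psi z : touches y (psi z) = false.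
  by case: z => [v'|e] /=; rewrite ?phiE ?inE ?yg ?(negPf (gy _)).
have notin z : touches x z || touches y z -> z \notin psi @: C.
  by apply: contraL => /imsetP[z' _ ->]; rewrite x_psi y_psi.
pose ux := phi None.
have x_ux : x \in val ux by rewrite phiE !inE eqxx orbT.
have y_ux : (y \in val ux) = false by rewrite phiE !inE yg yx.
have g_ux v : (g v \in val ux) = (v == u).
  by rewrite phiE !inE (inj_eq g_inj) (negPf (gx v)) orbF.
have x_notin : inl x \notin inl y |: (inr ux |: psi @: C).
  rewrite !in_setU1 !negb_or notin /= ?eqxx // andbT.
  by apply: contraNneq xy => -[->].
have y_notin : inl y \notin inr ux |: psi @: C.
  by rewrite in_setU1 negb_or notin //= eqxx orbT.
have ux_notin : inr ux \notin psi @: C by rewrite notin //= x_ux.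
exists (inl x |: (inl y |: (inr ux |: psi @: C))).
  by rewrite !cardsU1 x_notin y_notin ux_notin card_imset // addn3.
rewrite /signed_sum !sum_ffun_option mulr_sumr; apply: eq_bigr => eps _.
(* [D] is the excess in [G], and [U] is its value at [u]. *)
pose D z : R := \sum_e (-1) ^+ eps e * graph_entry R o e z.
pose U : R := \sum_e (-1) ^+ eps e *
   ((Defs.head o e == u)%:R - (tail o e == u)%:R).
pose sg (b : bool) : R := (-1) ^+ b.
(* The triangle edges at [u] have the signs [p] and [r], and they enter the
   columns of [C] only through the difference of these signs. *)
pose Q r p := \prod_(z in C) ((sg r - sg p) * (touches u z)%:R + D z).
have Qdiag b : Q b b = \prod_(z in C) D z.
  by apply: eq_bigr => z _; rewrite subrr mul0r add0r.
pose glue r q p : {ffun arc G -> bool} :=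
  [ffun i => match i with
     | None => p | Some None => q | Some (Some None) => r | Some (Some (Some e)) => eps e
   end].
have column r q p z : \sum_i (-1) ^+ glue r q p i * M' i z =
    sg p * ((touches x z)%:R - (touches (g u) z)%:R) +
    (sg q * ((touches y z)%:R - (touches x z)%:R) +
    (sg r * ((touches (g u) z)%:R - (touches y z)%:R) +
    \sum_e sg (eps e) * ((touches (g (Defs.head o e)) z)%:R
                          - (touches (g (tail o e)) z)%:R))).
  rewrite !big_option !ffunE; do 3![congr (_ + _)].
  by apply: eq_bigr => e _; rewrite ffunE.
have term r q p :
    (\prod_i (-1) ^+ glue r q p i) *
      \prod_(z in inl x |: (inl y |: (inr ux |: psi @: C)))
        \sum_i (-1) ^+ glue r q p i * M' i z =
    sg p * (sg q * (sg r * \prod_e sg (eps e))) *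
      ((sg p - sg q) * ((sg q - sg r) * ((sg r - sg q + U) * Q r p))).
  congr (_ * _).
    rewrite !big_option !ffunE; do 3![congr (_ * _)].
    by apply: eq_bigr => e _; rewrite ffunE.
  rewrite !big_setU1 //= big_imset /=; last by move=> ? ? _ _ /psi_inj.
  congr (_ * (_ * (_ * _))).
  - rewrite column /= eqxx xg (negPf xy) big1 => [|e _]; last by rewrite !xg; ring.
    by rewrite /=; ring.
  - rewrite column /= eqxx yg yx big1 => [|e _]; last by rewrite !yg; ring.
    by rewrite /=; ring.
  - rewrite column /= x_ux y_ux g_ux eqxx /U /=.
    under eq_bigr do rewrite !g_ux.
    by ring.
  - apply: eq_bigr => z _; rewrite column x_psi y_psi g_psi /=.
    under eq_bigr do
      rewrite !g_psi -/(arc_row R (tail o _) (Defs.head o _) z) -graph_entryE.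
    by rewrite -/(D z); ring.
transitivity (\sum_r \sum_q \sum_p (\prod_i (-1) ^+ glue r q p i) *
  \prod_(z in inl x |: (inl y |: (inr ux |: psi @: C)))
    \sum_i (-1) ^+ glue r q p i * M' i z).
  apply: eq_bigr => r _; apply: eq_bigr => q _; apply: eq_bigr => p _.
  have <- : glue r q p = [ffun o0 => if o0 is Some i then
     [ffun o1 => if o1 is Some i0 then
        [ffun o2 => if o2 is Some i1 then eps i1 else r] i0 else q] i else p].
    by apply/ffunP => -[[[e|]|]|]; rewrite !ffunE.
  by [].
(* Only the two terms with [p = r] and [q] opposite to them are nonzero. *)
rewrite !big_bool !term !Qdiag /sg /= !expr1 !expr0.
set P1 := \prod_(i in _) _; set P2 := \prod_i _.
by ring.
Qed.

Lemma triangle_pind_le1 (R : numFieldType) (G G' : sgraph) (u : G) (g : G -> G')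
    (x y : G') (o : orientation G) (o' : orientation G') :
  triangle_attached u g x y ->
  pind_le (graph_matrix R o) 1 -> pind_le (graph_matrix R o') 1.
Proof.
move=> ta /pind_le1_signed_sum[C cardC sum_neq0].
have [phi bij_phi phiE] := arc_bijection o ta.
have [C' cardC' sumC'] := signed_sum_triangle R C ta bij_phi phiE.
apply/pind_le1_signed_sum; exists C'.
  by rewrite cardC' cardC -(bij_eq_card bij_phi) !card_option addn3.
have [b ->] := signed_sum_orientation R o' C' bij_phi phiE.
by rewrite sumC' !mulf_neq0 ?signr_eq0 ?pnatr_eq0.
Qed.

Lemma is_pind1 (R : comNzRingType) m n (A : 'M[R]_(m, n)) :
  (0 < m)%N -> pind_le A 1 -> is_pind A 1.
Proof.
case: m A => // m A _ pind1; split=> // k [c [_ /(_ (c ord0)) le_k]].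
by apply: leq_trans le_k; apply/card_gt0P; exists ord0; rewrite inE.
Qed.

Theorem theorem4p2 (R : realType) (G : sgraph) (u : G)
  (w : complete_graph 3) (G' : sgraph) (o : orientation G) :
  connected G ->
  is_identification G' u w ->
  is_pind (graph_matrix R o) 1 ->
  (forall o' : orientation G', is_pind (graph_matrix R o') 1) /\
  choosable R G' 2 2.
Proof.
move=> _ /identification_triangle[g [x [y ta]]] [pind1 _].
have pind1' (o' : orientation G') : pind_le (graph_matrix R o') 1.
  exact: triangle_pind_le1 ta pind1.
split=> [o'|]; last first.
  have [o'] := orientation_exists G'.
  exact: pind_le1_choosable (pind1' o').
apply: is_pind1 => //; have [e _] := edge_of_adj (ta_adjxy ta).
by apply/card_gt0P; exists e.
Qed.
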